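(* There exist universal constants $c,C,C_1,c_1>0$ such that for all integers $n,k$ with $1\le k\le n/16$ and every fixed index $i^*\in\{1,\dots,n\}$ the following holds. Let $\tilde V$ be an $n\times k$ random matrix with i.i.d. $N(0,1)$ entries. Then with probability at least $1-C_1\left(e^{-c_1n}+e^{-c_1k}\right)$, $$c\,\frac{n}{\sqrt k}\ \le\ \min\left\{\|\tilde V\tilde x\|_1:\ \tilde x\in\mathbb{R}^k,\ (\tilde V\tilde x)(i^* )=1\right\}\ \le\ C\,\frac{n}{\sqrt k}.$$
   Context: $(\tilde V\tilde x)(i^* )$ denotes the $i^*$-th component of the vector $\tilde V\tilde x\in\mathbb{R}^n$. ''Universal'' means not depending on $n$, $k$ or $i^*$. *)

(* Defs.v *)
From mathcomp Require Export all_boot all_order all_algebra.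
From mathcomp Require Export all_classical all_reals all_analysis.

Set Implicit Arguments.
Unset Strict Implicit.
Unset Printing Implicit Defensive.

Import Order.TTheory GRing.Theory Num.Theory.

Local Open Scope classical_set_scope.
Local Open Scope ring_scope.

(* Mutual, not merely pairwise: the product rule over every subfamily J of X. *)
Definition mutually_independent (d : measure_display) (T : measurableType d)
    (R : realType) (P : probability T R) (I : finType)
    (X : I -> {RV P >-> R}) : Prop :=
  forall (J : {set I}) (B : I -> set R),
    (forall i, i \in J -> measurable (B i)) ->
    P (\bigcap_(i in [set i | i \in J]) X i @^-1` B i)
      = (\prod_(i in J) P (X i @^-1` B i))%E.

Definition standard_normal (d : measure_display) (T : measurableType d)
    (R : realType) (P : probability T R) (X : {RV P >-> R}) : Prop :=
  forall A : set R, measurable A -> distribution P X A = normal_prob 0 1 A.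

Definition iid_standard_normal_entries (d : measure_display)
    (T : measurableType d) (R : realType) (P : probability T R) (n k : nat)
    (V : 'I_n -> 'I_k -> {RV P >-> R}) : Prop :=
  (forall i j, standard_normal (V i j)) /\
  mutually_independent (fun ij : 'I_n * 'I_k => V ij.1 ij.2).

Definition sample_matrix (d : measure_display)
    (T : measurableType d) (R : realType) (P : probability T R) (n k : nat)
    (V : 'I_n -> 'I_k -> {RV P >-> R}) (w : T) : 'M[R]_(n, k) :=
  \matrix_(i, j) V i j w.

(* The norm `|v| that MathComp-Analysis puts on matrices is the sup norm. *)
Definition l1norm (R : realType) (n : nat) (v : 'cV[R]_n) : R :=
  \sum_(i < n) `|v i 0|.

Definition is_min (R : realType) (A : set R) (m : R) : Prop :=
  A m /\ lbound A m.

Definition feasible_l1norms (R : realType) (n k : nat) (A : 'M[R]_(n, k))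
    (i : 'I_n) : set R :=
  [set l1norm (A *m x) | x in [set x : 'cV[R]_k | (A *m x) i 0 = 1]].

(* Values of P are meaningful only on measurable sets, so measurability of the
   event is part of the assertion. *)
Definition with_probability_at_least (d : measure_display)
    (T : measurableType d) (R : realType) (P : probability T R)
    (p : R) (E : set T) : Prop :=
  measurable E /\ (p%:E <= P E)%E.

(* Main.v *)
Require Import Defs.
From HB Require Import structures.
From mathcomp Require Import measurable_realfun ring lra.
Set Implicit Arguments.
Unset Strict Implicit.
Unset Printing Implicit Defensive.
Import Order.TTheory GRing.Theory Num.Theory.
Import numFieldNormedType.Exports.
Local Open Scope classical_set_scope.
Local Open Scope ring_scope.

(* Write A for the random matrix, a for its row istar and q x for the squared
   euclidean norm of x.  Up to exponentially small probabilities,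
     n / 50 * sqrt (q x) <= |A x|_1 <= 3 n * sqrt (q x) for all x,   and
     k / 3 <= q a <= 4 k.
   The first chain gives the lower bound, since 1 = <a, x> <= sqrt (q a) sqrt (q x)
   for a feasible x, and the upper bound, at the feasible point x = a / q a.

   The first chain is a net argument.  The net consists of the lattice points
   of mesh 1 / (100 sqrt k) of l1-norm at most sqrt k; rounding towards zero maps
   the euclidean unit ball into it, and there are at most 606^k <= (3 / 2)^n net
   points as 16 k <= n.  For a fixed x, exponential moments suffice on both
   sides: the only integrals needed are those of exp of a diagonal quadratic form
   in the A x, computed by integrating out one entry of A at a time.  The lower
   tail follows from exp (- 20 |t|) <= exp (- 20 t^2) + exp (- 20).

   The minimum m is measurable since t <= m means that t |<a, x>| <= |A x|_1 for all
   rational vectors x. *)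

(** * Gaussian integrals *)

(** The measure is dominated by Lebesgue measure. Its Radon-Nikodym derivative agrees almost
    everywhere with the density, because both have the same integral over every measurable set. *)
Lemma ge0_integral_normal_prob (R : realType) (m s : R) (f : measurableTypeR R -> \bar R) :
  measurable_fun setT f -> (forall x, 0 <= f x)%E ->
  (\int[normal_prob m s]_x f x =
   \int[lebesgue_measure]_x (f x * (normal_pdf m s x)%:E))%E.
Proof.
move=> mf f0.
have dom := normal_prob_dominates m s.
rewrite -(Radon_Nikodym_SigmaFinite.change_of_variables dom)//.
have mpdf : measurable_fun setT (EFin \o normal_pdf m s).
  by apply/measurable_EFinP; exact: measurable_normal_pdf.
have iRN := Radon_Nikodym_SigmaFinite.f_integrable dom.
apply: ge0_ae_eq_integral => //.
- by apply: emeasurable_funM => //; exact: measurable_int iRN.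
- exact: emeasurable_funM.
- by move=> x _; rewrite mule_ge0// Radon_Nikodym_SigmaFinite.f_ge0.
- by move=> x _; rewrite mule_ge0// lee_fin normal_pdf_ge0.
- apply: ae_eqe_mul2l; apply: integral_ae_eq => //.
  by move=> E _ mE; rewrite -Radon_Nikodym_SigmaFinite.f_integral.
Qed.

(** Completing the square. The shift [s] is kept because the result is again the exponential of a
    quadratic form in [s], now with weight [l / (1 + l * x ^+ 2)]; this lets the integration be
    iterated over many variables. *)
Lemma integral_gauss_quadratic (R : realType) (l s x : R) : 0 < 1 + l * x ^+ 2 ->
  (\int[normal_prob 0 1]_g (expR (- (l * (s + x * g) ^+ 2 / 2)))%:E =
   ((Num.sqrt (1 + l * x ^+ 2))^-1 *
     expR (- (l / (1 + l * x ^+ 2) * s ^+ 2 / 2)))%:E)%E.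
Proof.
set D := 1 + l * x ^+ 2 => D0.
rewrite ge0_integral_normal_prob; last 2 first.
- apply/measurable_EFinP; apply: measurableT_comp => //.
  apply: measurableT_comp => //; apply: measurable_funM => //.
  apply: measurable_funM => //; apply: measurable_funX.
  by apply: measurable_funD => //; exact: measurable_funM.
- by move=> g; rewrite lee_fin expR_ge0.
(* Mean and deviation come from l (s + x g)^2 + g^2 = D (g - mu0)^2 + (l / D) s^2. *)
pose sg : R := (Num.sqrt D)^-1; pose mu0 : R := - (l * s * x / D).
have sD0 : 0 < Num.sqrt D by rewrite sqrtr_gt0.
have sg0 : sg != 0 by rewrite invr_neq0// gt_eqF.
have sg2 : sg ^+ 2 = D^-1 by rewrite exprVn sqr_sqrtr// ltW.
transitivity (\int[lebesgue_measure]_g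
  ((sg * expR (- (l / D * s ^+ 2 / 2)))%:E * (normal_pdf mu0 sg g)%:E))%E.
  apply: eq_integral => g _; rewrite -!EFinM; congr (_%:E).
  rewrite !normal_pdfE ?oner_neq0// /normal_peak /normal_fun.
  have -> : (Num.sqrt (sg ^+ 2 * pi *+ 2))^-1 = sg^-1 * (Num.sqrt (1 ^+ 2 * pi *+ 2))^-1.
    rewrite expr1n mul1r -[sg ^+ 2 * pi *+ 2]mulrnAr sqrtrM ?sqr_ge0//.
    by rewrite sqrtr_sqr ger0_norm ?invr_ge0 ?ltW// invfM.
  set p1 := (Num.sqrt (1 ^+ 2 * pi *+ 2))^-1.
  rewrite mulrCA; set E := expR _ * expR _.
  rewrite [RHS](_ : _ = p1 * (expR (- (l / D * s ^+ 2 / 2)) *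
      expR (- (g - mu0) ^+ 2 / (sg ^+ 2 *+ 2)))); last by field.
  rewrite /E -!expRD sg2 /mu0 -[D^-1 *+ 2]mulr_natl expr1n; congr (_ * expR _).
  have := D0; rewrite /D => D0'; field; rewrite gt_eqF//=.
rewrite ge0_integralZl//; last 3 first.
- by apply/measurable_EFinP; exact: measurable_normal_pdf.
- by move=> g _; rewrite lee_fin normal_pdf_ge0.
- by rewrite lee_fin mulr_ge0 ?expR_ge0// invr_ge0 ltW.
by rewrite integral_normal_pdf mule1.
Qed.

(* normal_prob lives on measurableTypeR R, which is R with another display:
   integrals are transported along the identity map. *)
Lemma ge0_integral_standard_normal d (T : measurableType d) (R : realType)
    (P : probability T R) (X : {RV P >-> R}) (f : R -> \bar R) :
  standard_normal X -> measurable_fun setT f -> (forall x, 0 <= f x)%E ->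
  (\int[distribution P X]_y f y = \int[normal_prob 0 1]_y f y)%E.
Proof.
move=> normX mf f0.
pose idR (y : measurableTypeR R) : R := y.
have midR : measurable_fun setT idR by move=> _ A mA; rewrite setTI.
transitivity (\int[pushforward (normal_prob 0 1) idR]_y f y)%E; last first.
  by rewrite ge0_integral_pushforward.
by apply: eq_measure_integral => A mA _; exact: normX.
Qed.

(** * Integrating out one variable of an independent family *)

Section peeling.
Context d (T : measurableType d) (R : realType) (P : probability T R).
Variables (I : finType) (X : I -> {RV P >-> R}) (i0 : I).

(** A pi-system generating the sigma-algebra of all the variables other than [X i0]. *)
Definition cylinders_off : set (set T) :=
  [set E | exists2 B : I -> set R, forall i, measurable (B i) &
    E = \bigcap_(i in [set i | i != i0]) X i @^-1` B i].

Lemma cylinders_off_measurable : cylinders_off `<=` measurable.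
Proof.
move=> _ [B mB ->]; apply: fin_bigcap_measurable; first exact: finite_finset.
by move=> i _; rewrite -[_ @^-1` _]setTI; exact: measurable_funP.
Qed.

Lemma cylinders_offI : setI_closed cylinders_off.
Proof.
move=> _ _ [B mB ->] [C mC ->]; exists (fun i => B i `&` C i).
  by move=> i; exact: measurableI.
by rewrite -bigcapI; apply: eq_bigcapr => i _; rewrite preimage_setI.
Qed.

Lemma cylinders_offT : cylinders_off setT.
Proof.
exists (fun=> setT) => //; apply/esym; rewrite -subTset => w _ i _ //.
Qed.

Lemma measurable_cylinders_off i : i != i0 ->
  measurable_fun [set: g_sigma_algebraType cylinders_off]
    (X i : g_sigma_algebraType cylinders_off -> R).
Proof.
move=> ii0 _ B mB; rewrite setTI; apply: sub_sigma_algebra.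
exists (fun j => if j == i then B else setT); first by move=> j; case: ifP.
apply/seteqP; split => w /=.
  by move=> XB j _; case: ifP => // /eqP->.
by move/(_ i ii0); rewrite eqxx.
Qed.

Hypothesis indepX : mutually_independent X.

(** The product rule is used twice, for the full index set and for the complement of [i0]; the two
    products differ by the factor of [i0]. *)
Lemma cylinders_off_indep (A : set R) E : measurable A -> cylinders_off E ->
  P (X i0 @^-1` A `&` E) = (P (X i0 @^-1` A) * P E)%E.
Proof.
move=> mA [B mB ->].
pose B' i := if i == i0 then A else B i.
have mB' i : measurable (B' i) by rewrite /B'; case: ifP.
have -> : X i0 @^-1` A `&` (\bigcap_(i in [set i | i != i0]) X i @^-1` B i) =
    \bigcap_(i in [set i | i \in [set: I]%SET]) X i @^-1` B' i.
  apply/seteqP; split => [w [Aw Bw] i _|w Bw]/=.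
    by rewrite /B'; case: eqVneq => [->//|ii0]; exact: Bw.
  split; first by have /= := Bw i0 (finset.in_setT _); rewrite /B' eqxx.
  by move=> i ii0; have /= := Bw i (finset.in_setT _); rewrite /B' (negbTE ii0).
have -> : \bigcap_(i in [set i | i != i0]) X i @^-1` B i =
    \bigcap_(i in [set i | i \in [set~ i0]%SET]) X i @^-1` B i.
  by congr bigcap; apply/seteqP; split => i /=; rewrite !inE.
rewrite !indepX// (bigD1 i0) ?finset.in_setT//= {1}/B' eqxx; congr (_ * _)%E.
apply: eq_big => [i|i /andP[_ ii0]]; first by rewrite !inE.
by rewrite /B' (negbTE ii0).
Qed.

(** As functions of [E], both sides are finite measures. They agree on the pi-system
    [cylinders_off], which contains the whole space, hence on the sigma-algebra it generates. *)
Lemma sigma_off_indep (A : set R) E :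
    measurable A -> <<s cylinders_off >> E ->
  P (X i0 @^-1` A `&` E) = (P (X i0 @^-1` A) * P E)%E.
Proof.
move=> mA; have mXA : measurable (X i0 @^-1` A).
  by rewrite -[_ @^-1` _]setTI; exact: measurable_funP.
pose p : {nonneg R} := NngNum (fine_ge0 (measure_ge0 P (X i0 @^-1` A))).
have pE : P (X i0 @^-1` A) = (p%:num%:E)%E by rewrite /= fineK// fin_num_measure.
pose m1 : {measure set T -> \bar R} := mrestr P mXA.
pose m2 : {measure set T -> \bar R} := mscale p P.
move=> sE; have /= := @g_sigma_algebra_measure_unique _ _ _ cylinders_off
  cylinders_off_measurable (fun=> setT) (fun=> cylinders_offT) _ m1 m2.
rewrite /m1 /m2 /mrestr /mscale/= -/p => H.
rewrite setIC pE; apply: H => //.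
- by rewrite bigcup_const//; exists 0%N.
- exact: cylinders_offI.
- by move=> F GF; rewrite setIC cylinders_off_indep// pE.
- by move=> _; rewrite setTI pE ltry.
Qed.

Let T2 := g_sigma_algebraType cylinders_off.

(** The identity into the coarser sigma-algebra; its law is the restriction of [P]. *)
Let inT2 (w : T) : T2 := w.

Let measurable_inT2 : measurable_fun setT inT2.
Proof.
move=> _ B mB; rewrite setTI.
exact: (smallest_sub (@sigma_algebra_measurable _ T) cylinders_off_measurable).
Qed.

HB.instance Definition _ := isMeasurableFun.Build _ _ _ _ inT2 measurable_inT2.

(** The sample point itself is the second coordinate. Independence makes the law of this pair a
    product measure, to which Tonelli's theorem applies. *)
Let joint (w : T) : R * T2 := (X i0 w, w).

Let measurable_joint : measurable_fun setT joint.
Proof. by apply: measurable_fun_pair => //. Qed.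

HB.instance Definition _ := isMeasurableFun.Build _ _ _ _ joint measurable_joint.

(* X i0 is independent of the sigma-algebra generated by the other variables, so
   that it can be integrated out of a function measurable for the latter. *)
Lemma ge0_integral_peel (F : R * T2 -> \bar R) :
  measurable_fun setT F -> (forall z, 0 <= F z)%E ->
  (\int[P]_w F (X i0 w, w) =
   \int[P]_w \int[distribution P (X i0)]_x F (x, w))%E.
Proof.
move=> mF F0.
transitivity (\int[distribution P joint]_z F z)%E.
  by rewrite ge0_integral_distribution.
transitivity (\int[distribution P (X i0) \x distribution P inT2]_z F z)%E.
  apply: eq_measure_integral => A mA _; apply/esym.
  apply: product_measure_unique => // B C mB mC.
  by rewrite /distribution /pushforward/= -sigma_off_indep.
rewrite fubini_tonelli1// fubini_tonelli//.
rewrite (ge0_integral_distribution (P := P))//.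
- exact: measurable_fun_fubini_tonelli_G.
- by move=> w; exact: integral_ge0.
Qed.

End peeling.

(** Induction on the size of [J], integrating out one variable at a time. The map [g] splits the
    variables into blocks, one linear form per block: with [g = fst] the blocks are matrix rows,
    with [g = id] single entries. Weights may be negative, which gives the upper tails. *)
Lemma integral_exp_gauss_forms d (T : measurableType d) (R : realType)
    (P : probability T R) (I K : finType) (X : I -> {RV P >-> R})
    (g : I -> K) (x : I -> R) (J : {set I}) (lam : K -> R) :
  mutually_independent X -> (forall i, standard_normal (X i)) ->
  (forall a, 0 < 1 + lam a * \sum_(i in J | g i == a) x i ^+ 2) ->
  (\int[P]_w (expR (- \sum_a
      lam a * (\sum_(i in J | g i == a) x i * X i w) ^+ 2 / 2))%:E =
   (\prod_a (Num.sqrt (1 + lam a * \sum_(i in J | g i == a) x i ^+ 2))^-1)%:E)%E.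
Proof.
move=> indepX normX; have [m] := ubnP #|J|; elim: m => // m IH in J lam *.
rewrite ltnS => Jm pos; have [J0|[i0 i0J]] := set_0Vmem J.
  have emp (F : I -> R) a : \sum_(i in J | g i == a) F i = 0.
    by rewrite big1// => i; rewrite J0 inE.
  rewrite [X in (_ = X%:E)%E]big1; last first.
    by move=> a _; rewrite emp mulr0 addr0 sqrtr1 invr1.
  transitivity (\int[P]_w (cst 1 w))%E; last by rewrite integral_cst//= probability_setT mule1.
  apply: eq_integral => w _; rewrite big1 ?oppr0 ?expR0// => a _.
  by rewrite emp expr0n mulr0 mul0r.
pose J' := J :\ i0; pose a0 := g i0.
pose D := 1 + lam a0 * x i0 ^+ 2.
have splitJ (F : I -> R) a :
    \sum_(i in J | g i == a) F i =
    (if a == a0 then F i0 else 0) + \sum_(i in J' | g i == a) F i.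
  have eqJ' : (fun i => (i \in J') && (g i == a)) =1
      (fun i => (i \in J) && (g i == a) && (i != i0)).
    by move=> i; rewrite !inE -andbA andbC.
  rewrite (eq_bigl _ _ eqJ'); case: eqVneq => [->|aa0].
    by rewrite (bigD1 i0)//= i0J eqxx.
  rewrite add0r; apply: eq_bigl => i; case: (eqVneq i i0) => [->|]; rewrite ?andbT//.
  by rewrite [g i0 == a]eq_sym (negbTE aa0) !andbF.
have x2_ge0 a : 0 <= \sum_(i in J' | g i == a) x i ^+ 2.
  by apply: sumr_ge0 => i _; exact: sqr_ge0.
(* If the weight is negative, the remaining squares only lower the total, so positivity for [J]
   implies positivity for [i0] alone. *)
have D0 : 0 < D.
  have := pos a0; rewrite splitJ eqxx /D; have := x2_ge0 a0.
  set s := \sum_(_ in _ | _) _ => s0 Ds0.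
  have [l0|l0] := lerP 0 (lam a0); first by rewrite ltr_pwDl// mulr_ge0// sqr_ge0.
  by apply: lt_le_trans Ds0 _; rewrite lerD2l mulrDr gerDl mulr_le0_ge0// ltW.
(* Integrating out [X i0] changes only the weight of its own block. The identity [lam'E] shows that
   the factor [D] splits off exactly, so the induction hypothesis for [J'] and [lam'] yields the
   product for [J] and [lam]. *)
pose lam' a := if a == a0 then lam a0 / D else lam a.
have lam'E a : 1 + lam a * \sum_(i in J | g i == a) x i ^+ 2 =
    (if a == a0 then D else 1) *
    (1 + lam' a * \sum_(i in J' | g i == a) x i ^+ 2).
  rewrite splitJ /lam'; case: eqVneq => [->|_]; last by rewrite add0r mul1r.
  by rewrite /D; field; rewrite gt_eqF.
pose S a w := \sum_(i in J' | g i == a) x i * X i w.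
pose rest w := \sum_(a | a != a0) lam a * S a w ^+ 2 / 2.
pose F (z : R * g_sigma_algebraType (cylinders_off X i0)) : \bar R :=
  (expR (- (lam a0 * (S a0 z.2 + x i0 * z.1) ^+ 2 / 2)) * expR (- rest z.2))%:E.
have mS a : measurable_fun [set: g_sigma_algebraType (cylinders_off X i0)]
    (S a : g_sigma_algebraType (cylinders_off X i0) -> R).
  rewrite /S; under eq_fun do rewrite big_mkcond.
  apply: measurable_sum => i; case: (boolP ((i \in J') && (g i == a))) => [/andP[iJ' _]|_]//.
  apply: measurable_funM => //; apply: measurable_cylinders_off.
  by move: iJ'; rewrite !inE => /andP[].
have mrest : measurable_fun [set: g_sigma_algebraType (cylinders_off X i0)]
    (rest : g_sigma_algebraType (cylinders_off X i0) -> R).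
  rewrite /rest; under eq_fun do rewrite big_mkcond.
  apply: measurable_sum => a; case: (a != a0) => //.
  by apply: measurable_funM => //; apply: measurable_funM => //; exact: measurable_funX.
have mF : measurable_fun setT F.
  apply/measurable_EFinP; apply: measurable_funM.
    apply: measurableT_comp => //; apply: measurableT_comp => //.
    apply: measurable_funM => //; apply: measurable_funM => //.
    apply: measurable_funX; apply: measurable_funD.
      exact: (measurableT_comp (mS a0)).
    by apply: measurable_funM => //.
  apply: measurableT_comp => //; apply: measurableT_comp => //.
  exact: (measurableT_comp mrest).
(* Functions measurable for the other variables are measurable on [T]. *)
have mP (h : g_sigma_algebraType (cylinders_off X i0) -> R) :
    measurable_fun setT h -> measurable_fun [set: T] (h : T -> R).
  move=> mh _ B mB; have := mh measurableT B mB; rewrite !setTI.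
  exact: (smallest_sub (@sigma_algebra_measurable _ T)
    (@cylinders_off_measurable _ _ _ _ _ X i0)).
transitivity (\int[P]_w F (X i0 w, w))%E.
  apply: eq_integral => w _; rewrite /F/= -expRD -opprD; congr (expR (- _))%:E.
  rewrite (bigD1 a0)//= splitJ eqxx [x i0 * _ + _]addrC; congr (_ + _).
  by apply: eq_bigr => a aa0; rewrite splitJ (negbTE aa0) add0r.
rewrite ge0_integral_peel//; last by move=> z; rewrite lee_fin mulr_ge0 ?expR_ge0.
transitivity (\int[P]_w ((Num.sqrt D)^-1%:E *
    (expR (- \sum_a lam' a * S a w ^+ 2 / 2))%:E))%E.
  apply: eq_integral => w _; rewrite /F/=.
  transitivity (\int[normal_prob 0 1]_y ((expR (- rest w))%:E *
      (expR (- (lam a0 * (S a0 w + x i0 * y) ^+ 2 / 2)))%:E))%E.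
    rewrite ge0_integral_standard_normal//.
      by apply: eq_integral => y _; rewrite mulrC EFinM.
    by have := @measurable_fun_pair1 _ _ _ _ _ _ F w mF.
  rewrite ge0_integralZl//; last first.
    apply/measurable_EFinP; apply: measurableT_comp => //.
    apply: measurableT_comp => //; apply: measurable_funM => //.
    apply: measurable_funM => //; apply: measurable_funX.
    by apply: measurable_funD => //; exact: measurable_funM.
  rewrite integral_gauss_quadratic// -!EFinM mulrCA -expRD -opprD.
  congr (_ * expR (- _))%:E; rewrite (bigD1 a0)//= /lam' eqxx addrC; congr (_ + _).
  by apply: eq_bigr => a aa0; rewrite (negbTE aa0).
rewrite ge0_integralZl//; last first.
  apply/measurable_EFinP; apply: measurableT_comp => //.
  apply: measurableT_comp => //; apply: measurable_sum => a.
  apply: measurable_funM => //; apply: measurable_funM => //.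
  by apply: measurable_funX; exact: mP.
rewrite IH; last 2 first.
- by apply: leq_trans Jm; rewrite [in X in (_ < X)%N](cardsD1 i0) i0J.
- move=> a; have := pos a; rewrite lam'E; case: ifP => _; last by rewrite mul1r.
  by rewrite pmulr_rgt0.
rewrite -EFinM; congr _%:E; under [in RHS]eq_bigr => a _.
  rewrite lam'E sqrtrM ?invfM; last by case: ifP => _ //; exact: ltW.
  over.
rewrite big_split/=; congr (_ * _); rewrite (bigD1 a0)//= eqxx big1 ?mulr1//.
by move=> a /negbTE ->; rewrite sqrtr1 invr1.
Qed.

(** * Tail bounds *)

Lemma big_pair_fst (S : Type) (idx : S) (op : Monoid.com_law idx) (I J : finType)
    (i : I) (F : I * J -> S) :
  \big[op/idx]_(p | p.1 == i) F p = \big[op/idx]_j F (i, j).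
Proof.
rewrite -[RHS](big_pred1_eq op i (fun i => \big[op/idx]_j F (i, j))).
rewrite pair_big_dep/=; apply: eq_big => [[a b]|[a b] _]//=.
by rewrite andbT.
Qed.

Definition sqnorm (R : realType) (k : nat) (x : 'cV[R]_k) : R :=
  \sum_j x j 0 ^+ 2.

Lemma sqnorm_ge0 (R : realType) (k : nat) (x : 'cV[R]_k) : 0 <= sqnorm x.
Proof. by apply: sumr_ge0 => j _; exact: sqr_ge0. Qed.

(** From exp (- 1/8) >= 7/8 one gets e <= (8/7)^8, which is below 3. *)
Lemma expR1_le3 (R : realType) : expR 1 <= 3 :> R.
Proof.
have -> : 1 = 8 * 8^-1 :> R by field.
have h : 7 / 8 <= expR (- 8^-1 : R) by apply: le_trans (expR_ge1Dx _); lra.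
have h2 : expR (8^-1 : R) <= 8 / 7.
  by rewrite -[8^-1]opprK expRN -lef_pV2 ?invrK ?posrE ?invr_gt0 ?expR_gt0//; lra.
rewrite expRM_natl; apply: (@le_trans _ _ ((8 / 7) ^+ 8)); last by lra.
by rewrite lerXn2r// nnegrE ?expR_ge0//; lra.
Qed.

Lemma expR_half_le (R : realType) : expR 2^-1 <= 7 / 4 :> R.
Proof.
rewrite -(@ler_pXn2r _ 2)// ?nnegrE ?expR_ge0//.
have := expR1_le3 R; rewrite {1}(_ : 1 = 2 * 2^-1 :> R); last by field.
by rewrite expRM_natl => /le_trans; apply; lra.
Qed.

Lemma expRN1_le (R : realType) : expR (-1) <= 4 / 9 :> R.
Proof.
rewrite expRN; have h : 3 / 2 <= expR 2^-1 :> R.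
  by apply: le_trans (expR_ge1Dx _); lra.
have h1 : 9 / 4 <= expR 1 :> R.
  by rewrite (_ : 1 = 2 * 2^-1 :> R) ?expRM_natl; [nra|field].
by rewrite -[4 / 9]invrK lef_pV2 ?posrE ?expR_gt0//; lra.
Qed.

Lemma sqrt_half_ge (R : realType) (q : R) : 2^-1 <= q -> (Num.sqrt q)^-1 <= 10 / 7.
Proof.
move=> q2; have h : 7 / 10 <= Num.sqrt q.
  rewrite -[7 / 10]ger0_norm; last lra.
  by rewrite -sqrtr_sqr ler_wsqrtr//; lra.
by rewrite -[10 / 7]invrK lef_pV2 ?posrE; lra.
Qed.

(** Markov's inequality for a majorant of the indicator; every exponential-moment bound below passes
    through it. *)
Lemma probability_le_integral d (T : measurableType d) (R : realType)
    (P : probability T R) (E : set T) (f : T -> R) :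
  measurable E -> measurable_fun setT f -> (forall w, 0 <= f w) ->
  (forall w, E w -> 1 <= f w) -> (P E <= \int[P]_w (f w)%:E)%E.
Proof.
move=> mE mf f0 f1; rewrite -[E]setIT -integral_indic//.
apply: ge0_le_integral => //.
- by apply/measurable_EFinP; exact: measurable_indic.
- exact/measurable_EFinP.
- move=> w _; rewrite lee_fin indicE; case: (boolP (w \in E)) => [|_]; last exact: f0.
  by rewrite inE => /f1.
Qed.

(** * Exponential moments of the rows of the product with a fixed vector *)

Section gaussian_matrix.
Context d (T : measurableType d) (R : realType) (P : probability T R).
Variables (n k : nat) (V : 'I_n -> 'I_k -> {RV P >-> R}).
Hypothesis iidV : iid_standard_normal_entries V.

Lemma sample_mulmxE (y : 'cV[R]_k) w i :
  (sample_matrix V w *m y) i 0 = \sum_j y j 0 * V i j w.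
Proof. by rewrite mxE; apply: eq_bigr => j _; rewrite mxE mulrC. Qed.

Lemma measurable_sample_mulmx (y : 'cV[R]_k) i :
  measurable_fun setT (fun w => (sample_matrix V w *m y) i 0).
Proof.
under eq_fun do rewrite sample_mulmxE.
by apply: measurable_sum => j; exact: measurable_funM.
Qed.

Lemma measurable_l1norm_sample (y : 'cV[R]_k) :
  measurable_fun setT (fun w => l1norm (sample_matrix V w *m y)).
Proof.
apply: measurable_sum => i; apply: measurableT_comp => //.
exact: measurable_sample_mulmx.
Qed.

(** The blocks are the rows. The weight depends on the row because the lower tail expands a product
    and needs weight 40 on some rows and 0 on the others. *)
Lemma integral_exp_rows (y : 'cV[R]_k) (lam : 'I_n -> R) :
  (forall i, 0 < 1 + lam i * sqnorm y) ->
  (\int[P]_w (expR (- \sum_i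
      lam i * ((sample_matrix V w *m y) i 0) ^+ 2 / 2))%:E =
   (\prod_i (Num.sqrt (1 + lam i * sqnorm y))^-1)%:E)%E.
Proof.
move=> pos; case: iidV => normV indV.
have rowE (F : 'I_n * 'I_k -> R) a :
    \sum_(p in [set: 'I_n * 'I_k]%SET | p.1 == a) F p = \sum_j F (a, j).
  by rewrite -(big_pair_fst _ a F); apply: eq_bigl => p; rewrite finset.in_setT.
have := @integral_exp_gauss_forms _ _ _ P _ _ (fun p : 'I_n * 'I_k => V p.1 p.2)
  fst (fun p => y p.2 0) [set: _]%SET lam indV (fun p => normV p.1 p.2).
have pos' a : 0 < 1 + lam a *
    \sum_(p in [set: 'I_n * 'I_k]%SET | p.1 == a) y p.2 0 ^+ 2 by rewrite rowE.
move=> /(_ pos'); under [in RHS]eq_bigr do rewrite rowE.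
move=> <-; apply: eq_integral => w _; congr (expR (- _))%:E.
by apply: eq_bigr => a _; rewrite rowE sample_mulmxE.
Qed.

End gaussian_matrix.

Section gaussian_tails.
Context d (T : measurableType d) (R : realType) (P : probability T R).
Variables (n k : nat) (V : 'I_n -> 'I_k -> {RV P >-> R}).
Hypothesis iidV : iid_standard_normal_entries V.
Local Notation A w := (sample_matrix V w).

Lemma l1norm_sample_upper_tail (y : 'cV[R]_k) : sqnorm y <= 1 ->
  (P [set w | (2 * n%:R <= l1norm (A w *m y))%R] <= ((13 / 20) ^+ n)%:E)%E.
Proof.
move=> y1; have y0 := sqnorm_ge0 y.
have pos : 0 < 1 - 2^-1 * sqnorm y by lra.
pose f w : R := expR (- 1) ^+ n *
  expR (- \sum_i (- 2^-1) * ((A w *m y) i 0) ^+ 2 / 2).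
have mS : measurable_fun setT (fun w => expR (- \sum_i
    (- 2^-1) * ((A w *m y) i 0) ^+ 2 / 2)).
  apply: measurableT_comp => //; apply: measurableT_comp => //.
  apply: measurable_sum => i; apply: measurable_funM => //.
  by apply: measurable_funM => //; apply: measurable_funX; exact: measurable_sample_mulmx.
apply: (@le_trans _ _ (\int[P]_w (f w)%:E)%E).
  apply: probability_le_integral.
  - rewrite -[X in measurable X]setTI.
    apply: (measurable_fun_le (f := cst (2 * n%:R))) => //.
    exact: measurable_l1norm_sample.
  - exact: measurable_funM.
  - by move=> w; rewrite mulr_ge0 ?exprn_ge0 ?expR_ge0.
  - move=> w /= h; rewrite /f -expRM_natl -expRD -[leLHS]expR0 ler_expR.
    have -> : n%:R * -1 = \sum_(i < n) -1 :> R by rewrite sumr_const card_ord mulr_natl.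
    rewrite -sumrN -big_split/=.
    apply: (@le_trans _ _ (\sum_i (`|(A w *m y) i 0| - 2))).
      rewrite sumrB sumr_const card_ord subr_ge0; move: h.
      by rewrite -[2 *+ n]mulr_natr.
    (* Row by row, |t| - 2 <= t^2 / 4 - 1, which is (|t| / 2 - 1)^2 >= 0. The resulting rate is at
       most (4/9) (10/7) = 40/63 < 13/20. *)
    apply: ler_sum => i _; rewrite -[X in _ <= _ - _ * X / 2]real_normK ?num_real//.
    by have := sqr_ge0 (`|(A w *m y) i 0| / 2 - 1); nra.
rewrite /f; under eq_integral do rewrite EFinM.
rewrite ge0_integralZl//; last by apply/measurable_EFinP.
rewrite (integral_exp_rows iidV (lam := fun=> - 2^-1)); last by move=> _; rewrite mulNr.
rewrite prodr_const card_ord -EFinM lee_fin -exprMn mulNr.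
rewrite lerXn2r ?nnegrE ?mulr_ge0 ?expR_ge0 ?invr_ge0//.
have h1 := expRN1_le R; have h2 : (Num.sqrt (1 - 2^-1 * sqnorm y))^-1 <= 10 / 7.
  by apply: sqrt_half_ge; lra.
apply: le_trans (ler_pM (expR_ge0 _) _ h1 h2) _; first by rewrite invr_ge0.
by lra.
Qed.

Lemma l1norm_sample_lower_tail (y : 'cV[R]_k) : 49 / 50 <= sqnorm y ->
  (P [set w | (l1norm (A w *m y) <= n%:R / 20)%R] <= ((13 / 20) ^+ n)%:E)%E.
Proof.
move=> y1.
have pos : 0 < 1 + 40 * sqnorm y by lra.
pose G : R := (Num.sqrt (1 + 40 * sqnorm y))^-1.
pose c : R := expR (- 20).
(* One term of the expanded product over the rows: rows marked by [s] take the gaussian factor, the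
   others the constant [c]. *)
pose F (s : {ffun 'I_n -> bool}) w : R :=
  (expR 1 ^+ n * \prod_i (if s i then 1 else c)) *
  expR (- \sum_i (if s i then 40 else 0) * ((A w *m y) i 0) ^+ 2 / 2).
have mS (s : {ffun 'I_n -> bool}) : measurable_fun setT (fun w => expR (- \sum_i
    (if s i then 40 else 0) * ((A w *m y) i 0) ^+ 2 / 2)).
  apply: measurableT_comp => //; apply: measurableT_comp => //.
  apply: measurable_sum => i; apply: measurable_funM => //.
  by apply: measurable_funM => //; apply: measurable_funX; exact: measurable_sample_mulmx.
have c0 (s : {ffun 'I_n -> bool}) : 0 <= expR 1 ^+ n * \prod_i (if s i then 1 else c).
  by rewrite mulr_ge0 ?exprn_ge0 ?expR_ge0// prodr_ge0// => i _; case: ifP; rewrite ?expR_ge0.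
have F0 s w : 0 <= F s w by rewrite mulr_ge0 ?expR_ge0.
have sumFE w : \sum_s F s w =
    \prod_i (expR 1 * (expR (- (40 * ((A w *m y) i 0) ^+ 2 / 2)) + c)).
  rewrite big_split/= prodr_const card_ord.
  have -> : \prod_i (expR (- (40 * ((A w *m y) i 0) ^+ 2 / 2)) + c) =
      \prod_i \sum_(b : bool) (if b then expR (- (40 * ((A w *m y) i 0) ^+ 2 / 2)) else c).
    by apply: eq_bigr => i _; rewrite big_bool.
  rewrite bigA_distr_bigA mulr_sumr; apply: eq_bigr => s _.
  rewrite /F -sumrN expR_sum -mulrA -big_split/=; congr (_ * _).
  apply: eq_bigr => i _; case: ifP => _; rewrite ?mul1r//.
  by rewrite !mul0r oppr0 expR0 mulr1.
apply: (@le_trans _ _ (\int[P]_w (\sum_s F s w)%:E)%E).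
  apply: probability_le_integral.
  - rewrite -[X in measurable X]setTI.
    apply: (measurable_fun_le (g := cst (n%:R / 20))) => //.
    exact: measurable_l1norm_sample.
  - by apply: measurable_sum => s; exact: measurable_funM.
  - by move=> w; exact: sumr_ge0.
  - move=> w /= h; rewrite sumFE.
    apply: (@le_trans _ _ (\prod_i expR (1 - 20 * `|(A w *m y) i 0|))).
      rewrite -expR_sum -[leLHS]expR0 ler_expR sumrB sumr_const card_ord -mulr_sumr.
      by move: h; rewrite /l1norm; lra.
    apply: ler_prod => i _; rewrite expR_ge0/= expRD ler_pM2l ?expR_gt0//.
    set t := (A w *m y) i 0; rewrite -[t ^+ 2]real_normK ?num_real//.
    (* For |t| <= 1 the gaussian term dominates since t^2 <= |t|; otherwise [c] does. *)
    have t0 := normr_ge0 t; have [t1|t1] := lerP `|t| 1.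
      by apply: ler_wpDr; rewrite ?expR_ge0// ler_expR; nra.
    by apply: ler_wpDl; rewrite ?expR_ge0// ler_expR; lra.
under eq_integral do rewrite -sumEFin.
rewrite ge0_integral_sum//; last 2 first.
- by move=> s; apply/measurable_EFinP; exact: measurable_funM.
- by move=> s w _; rewrite lee_fin.
have IF s : (\int[P]_w (F s w)%:E = (\prod_i (expR 1 * (if s i then G else c)))%:E)%E.
  rewrite /F; under eq_integral do rewrite EFinM.
  rewrite ge0_integralZl//; [|exact/measurable_EFinP|by rewrite lee_fin].
  rewrite (integral_exp_rows iidV (lam := fun i => if s i then 40 else 0)); last first.
    by move=> i; case: ifP => //; rewrite mul0r addr0.
  rewrite -EFinM; congr _%:E; rewrite [RHS]big_split/= prodr_const card_ord.
  rewrite -mulrA -big_split/=; congr (_ * _); apply: eq_bigr => i _.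
  by case: ifP; rewrite ?mul1r// mul0r addr0 sqrtr1 invr1 mulr1.
under eq_bigr do rewrite IF.
rewrite sumEFin lee_fin -(bigA_distr_bigA (fun _ b => expR 1 * (if b then G else c))).
under eq_bigr do rewrite big_bool/=.
rewrite prodr_const card_ord lerXn2r ?nnegrE ?addr_ge0 ?mulr_ge0 ?expR_ge0 ?invr_ge0//.
have e3 := expR1_le3 R; have e0 := expR_ge0 (1 : R).
(* As 1 + 40 (49/50) >= 36, each row contributes at most 3 (1/6 + 1/21) = 9/14 < 13/20. *)
have G6 : G <= 6^-1.
  rewrite lef_pV2 ?posrE ?sqrtr_gt0// -[6]ger0_norm// -sqrtr_sqr ler_wsqrtr//.
  by lra.
have c1 : c <= 21^-1.
  by rewrite /c expRN lef_pV2 ?posrE ?expR_gt0//; apply: le_trans (expR_ge1Dx _); lra.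
have G0 : 0 <= G by rewrite invr_ge0.
have c00 : 0 <= c by exact: expR_ge0.
nra.
Qed.

(** Every entry is its own block with coefficient 1, and [J] keeps only row [i]; this produces a sum
    of squares instead of the square of a sum. *)
Lemma integral_exp_row_sqr (i : 'I_n) (mu : R) : 0 < 1 + mu ->
  (\int[P]_w (expR (- (mu / 2 * \sum_j V i j w ^+ 2)))%:E =
   ((Num.sqrt (1 + mu))^-1 ^+ k)%:E)%E.
Proof.
move=> pos; case: iidV => normV indV.
pose J : {set 'I_n * 'I_k} := [set p | p.1 == i]%SET.
have sumJ (F : 'I_n * 'I_k -> R) p :
    \sum_(q in J | q == p) F q = if p.1 == i then F p else 0.
  by rewrite big_mkcondl/= big_pred1_eq inE.
have := @integral_exp_gauss_forms _ _ _ P _ _ (fun p : 'I_n * 'I_k => V p.1 p.2)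
  id (fun=> 1) J (fun=> mu) indV (fun p => normV p.1 p.2).
have pos' p : 0 < 1 + mu * \sum_(q in J | q == p) 1 ^+ 2.
  by rewrite sumJ expr1n; case: ifP => _; rewrite ?mulr1 ?mulr0 ?addr0.
move=> /(_ pos') H.
transitivity (\prod_(p : 'I_n * 'I_k) (if p.1 == i then (Num.sqrt (1 + mu))^-1 else 1))%:E.
  transitivity (\prod_(p : 'I_n * 'I_k)
      (Num.sqrt (1 + mu * \sum_(q in J | q == p) 1 ^+ 2))^-1)%:E; last first.
    congr _%:E; apply: eq_bigr => p _; rewrite sumJ expr1n; case: ifP => _.
      by rewrite mulr1.
    by rewrite mulr0 addr0 sqrtr1 invr1.
  rewrite -H; apply: eq_integral => w _; congr (expR (- _))%:E.
  rewrite mulr_sumr.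
  transitivity (\sum_(p : 'I_n * 'I_k) if p.1 == i then mu / 2 * V p.1 p.2 w ^+ 2 else 0).
    by rewrite -big_mkcond/= (big_pair_fst _ i (fun p => mu / 2 * V p.1 p.2 w ^+ 2)).
  apply: eq_bigr => p _; rewrite sumJ mul1r; case: ifP => _; last first.
    by rewrite expr0n mulr0 mul0r.
  by rewrite mulrAC.
congr _%:E; rewrite -big_mkcond/= (big_pair_fst _ i (fun=> (Num.sqrt (1 + mu))^-1)).
by rewrite prodr_const card_ord.
Qed.

Lemma measurable_row_sqr (i : 'I_n) :
  measurable_fun setT (fun w => \sum_j V i j w ^+ 2).
Proof. by apply: measurable_sum => j; exact: measurable_funX. Qed.

Lemma row_sqr_upper_tail (i : 'I_n) :
  (P [set w | (4 * k%:R <= \sum_j V i j w ^+ 2)%R] <= ((13 / 20) ^+ k)%:E)%E.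
Proof.
have mS := measurable_row_sqr i.
pose f w : R := expR (- 1) ^+ k * expR (- (- 2^-1 / 2 * \sum_j V i j w ^+ 2)).
have mE : measurable_fun setT (fun w => expR (- (- 2^-1 / 2 * \sum_j V i j w ^+ 2))).
  apply: measurableT_comp => //; apply: measurableT_comp => //.
  exact: measurable_funM.
apply: (@le_trans _ _ (\int[P]_w (f w)%:E)%E).
  apply: probability_le_integral.
  - rewrite -[X in measurable X]setTI.
    exact: (measurable_fun_le (f := cst (4 * k%:R))).
  - exact: measurable_funM.
  - by move=> w; rewrite mulr_ge0 ?exprn_ge0 ?expR_ge0.
  - move=> w /= h; rewrite /f -expRM_natl -expRD -[leLHS]expR0 ler_expR.
    by move: h; set s := \sum_j _; lra.
rewrite /f; under eq_integral do rewrite EFinM.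
rewrite ge0_integralZl//; last by apply/measurable_EFinP.
rewrite (integral_exp_row_sqr i (mu := - 2^-1)); last by lra.
rewrite -EFinM lee_fin -exprMn lerXn2r ?nnegrE ?mulr_ge0 ?expR_ge0 ?invr_ge0//.
have h1 := expRN1_le R; have h2 : (Num.sqrt (1 - 2^-1 : R))^-1 <= 10 / 7.
  by apply: sqrt_half_ge; lra.
apply: le_trans (ler_pM (expR_ge0 _) _ h1 h2) _; first by rewrite invr_ge0.
by lra.
Qed.

Lemma row_sqr_lower_tail (i : 'I_n) :
  (P [set w | (\sum_j V i j w ^+ 2 <= k%:R / 3)%R] <= ((7 / 8) ^+ k)%:E)%E.
Proof.
have mS := measurable_row_sqr i.
pose f w : R := expR 2^-1 ^+ k * expR (- (3 / 2 * \sum_j V i j w ^+ 2)).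
have mE : measurable_fun setT (fun w => expR (- (3 / 2 * \sum_j V i j w ^+ 2))).
  apply: measurableT_comp => //; apply: measurableT_comp => //.
  exact: measurable_funM.
apply: (@le_trans _ _ (\int[P]_w (f w)%:E)%E).
  apply: probability_le_integral.
  - rewrite -[X in measurable X]setTI.
    exact: (measurable_fun_le (g := cst (k%:R / 3))).
  - exact: measurable_funM.
  - by move=> w; rewrite mulr_ge0 ?exprn_ge0 ?expR_ge0.
  - move=> w /= h; rewrite /f -expRM_natl -expRD -[leLHS]expR0 ler_expR.
    by move: h; set s := \sum_j _; lra.
rewrite /f; under eq_integral do rewrite EFinM.
rewrite ge0_integralZl//; last by apply/measurable_EFinP.
(* The value 3 makes the square root equal to 2, so the rate is exp (1/2) / 2 <= 7/8. *)
rewrite (integral_exp_row_sqr i (mu := 3)); last by lra.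
rewrite -EFinM lee_fin -exprMn lerXn2r ?nnegrE ?mulr_ge0 ?expR_ge0 ?invr_ge0//.
have -> : Num.sqrt (1 + 3 : R) = 2.
  by rewrite (_ : 1 + 3 = 2 ^+ 2) ?sqrtr_sqr ?ger0_norm//; ring.
by have := expR_half_le R; lra.
Qed.

End gaussian_tails.

(** * The net argument *)

(** Lagrange's identity: the double sum of the squares [(a i * b j - a j * b i) ^+ 2] is twice the
    difference of the two sides. *)
Lemma cauchy_schwarz_sum (R : realFieldType) (I : finType) (a b : I -> R) :
  (\sum_i a i * b i) ^+ 2 <= (\sum_i a i ^+ 2) * (\sum_i b i ^+ 2).
Proof.
have : 0 <= \sum_i \sum_j (a i * b j - a j * b i) ^+ 2.
  by apply: sumr_ge0 => i _; apply: sumr_ge0 => j _; exact: sqr_ge0.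
have -> : \sum_i \sum_j (a i * b j - a j * b i) ^+ 2 =
    \sum_i \sum_j (a i ^+ 2 * b j ^+ 2) +
    \sum_i \sum_j (b i ^+ 2 * a j ^+ 2) -
    2 * \sum_i \sum_j ((a i * b i) * (a j * b j)).
  rewrite mulr_sumr -big_split/= -sumrB; apply: eq_bigr => i _.
  by rewrite mulr_sumr -big_split/= -sumrB; apply: eq_bigr => j _; ring.
rewrite -!big_distrlr/= expr2 [X in _ + X - _]mulrC; lra.
Qed.

Section l1norm_theory.
Variables (R : realType).

Lemma l1norm_ge0 n (v : 'cV[R]_n) : 0 <= l1norm v.
Proof. by apply: sumr_ge0 => i _. Qed.

Lemma l1normZ n (a : R) (v : 'cV[R]_n) : l1norm (a *: v) = `|a| * l1norm v.
Proof. by rewrite mulr_sumr; apply: eq_bigr => i _; rewrite mxE normrM. Qed.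

Lemma l1norm_triangle n (u v : 'cV[R]_n) : l1norm (u + v) <= l1norm u + l1norm v.
Proof.
by rewrite -big_split/=; apply: ler_sum => i _; rewrite mxE; exact: ler_normD.
Qed.

Lemma sqnormZ k (a : R) (x : 'cV[R]_k) : sqnorm (a *: x) = a ^+ 2 * sqnorm x.
Proof. by rewrite mulr_sumr; apply: eq_bigr => i _; rewrite mxE exprMn. Qed.

Lemma sqnorm_eq0 k (x : 'cV[R]_k) : sqnorm x = 0 -> x = 0.
Proof.
move=> /eqP; rewrite psumr_eq0 => [/allP x0|j _]; last exact: sqr_ge0.
apply/colP => j; rewrite mxE; apply/eqP.
by have := x0 j (mem_index_enum j); rewrite sqrf_eq0.
Qed.

Lemma norm_mulmx_row_le n k (A : 'M[R]_(n, k)) (x : 'cV[R]_k) i :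
  `|(A *m x) i 0| <= Num.sqrt (\sum_j A i j ^+ 2) * Num.sqrt (sqnorm x).
Proof.
rewrite -sqrtrM; last by apply: sumr_ge0 => j _; exact: sqr_ge0.
by rewrite mxE -sqrtr_sqr ler_wsqrtr// cauchy_schwarz_sum.
Qed.

(** A crude bound that makes the supremum in [ball_bound] finite. *)
Lemma l1norm_mulmx_bounded n k (A : 'M[R]_(n, k)) (x : 'cV[R]_k) :
  sqnorm x <= 1 -> l1norm (A *m x) <= \sum_i Num.sqrt (\sum_j A i j ^+ 2).
Proof.
move=> x1; apply: ler_sum => i _; apply: le_trans (norm_mulmx_row_le _ _ _) _.
by rewrite ler_piMr// -sqrtr1 ler_wsqrtr.
Qed.

End l1norm_theory.

Section net.
Variables (R : realType) (k : nat).

(* A sign bit and a modulus in units of the mesh for each coordinate. *)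
Definition net_index := {ffun 'I_k -> bool * 'I_(100 * k).+1}.

(** In units of the mesh, [100 * k] is the l1-radius sqrt k. A zero modulus may carry either sign,
    so points repeat; only an upper bound on the count is wanted. *)
Definition net : {set net_index} :=
  [set z : net_index | (\sum_j (z j).2 <= 100 * k)%N]%SET.

Definition net_point (z : net_index) : 'cV[R]_k :=
  \col_j ((-1) ^+ (z j).1 * ((z j).2%:R / (100 * Num.sqrt k%:R))).

Lemma geometric_sum_le m : \sum_(i < m) (100 / 101) ^+ i <= 101 :> R.
Proof.
have h := subrXX 1 (100 / 101 : R) m.
have -> : \sum_(i < m) (100 / 101) ^+ i = 101 * (1 - (100 / 101 : R) ^+ m).
  rewrite -[X in 101 * (X - _)](expr1n _ m) h.
  under [in RHS]eq_bigr do rewrite expr1n mul1r.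
  by rewrite mulrA (_ : 101 * (1 - 100 / 101) = 1) ?mul1r//; field.
by have := exprn_ge0 m (_ : 0 <= 100 / 101 :> R) => /(_ ltac:(lra)); lra.
Qed.

(* Each index is weighted by (101/100) ^ (100k - sum of the moduli) >= 1, which
   factorizes over the coordinates. *)
Lemma card_net_le : #|net|%:R <= 606 ^+ k :> R.
Proof.
pose wt (z : net_index) : R :=
  \prod_j ((101 / 100) ^+ 100 * (100 / 101) ^+ (z j).2).
have wt0 z : 0 <= wt z by apply: prodr_ge0 => j _; apply: mulr_ge0; apply: exprn_ge0; lra.
have wgt a b : (b <= a)%N -> 1 <= (101 / 100) ^+ a * (100 / 101) ^+ b :> R.
  move=> hz; rewrite -(subnK hz) exprD -mulrA -exprMn.
  rewrite (_ : 101 / 100 * (100 / 101) = 1); last by field.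
  by rewrite expr1n mulr1 exprn_ege1//; lra.
have wt1 z : z \in net -> 1 <= wt z.
  rewrite inE => hz; rewrite /wt big_split/= prodr_const card_ord -exprM.
  by rewrite -(big_morph _ (exprD (100 / 101 : R)) (expr0 _)); exact: wgt.
apply: (@le_trans _ _ (\sum_(z in net) wt z)).
  by rewrite -sum1_card natr_sum; exact: ler_sum.
apply: (@le_trans _ _ (\sum_z wt z)).
  by rewrite [leRHS](bigID (mem net))/= ler_wpDr// sumr_ge0.
rewrite -(bigA_distr_bigA (fun (_ : 'I_k) (bm : bool * 'I_(100 * k).+1) =>
  (101 / 100) ^+ 100 * (100 / 101) ^+ bm.2)) prodr_const card_ord.
apply: lerXn2r; rewrite ?nnegrE; [|by lra|].
  by apply: sumr_ge0 => bm _; apply: mulr_ge0; apply: exprn_ge0; lra.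
rewrite -mulr_sumr.
rewrite -(pair_bigA _ (fun (_ : bool) (m : 'I_(100 * k).+1) => (100 / 101 : R) ^+ m))/=.
rewrite big_bool/=; have h := geometric_sum_le (100 * k).+1.
(* The base 606 is 3 times 2 times 101: this bound, the two signs, and the geometric series. *)
have e : (101 / 100) ^+ 100 <= 3 :> R.
  apply: le_trans (expR1_le3 R).
  rewrite (_ : 1 = 100%:R * (1 / 100) :> R); last by field.
  rewrite expRM_natl; apply: lerXn2r; rewrite ?nnegrE ?expR_ge0; [lra|by []|].
  by apply: le_trans (expR_ge1Dx _); lra.
apply: le_trans (ler_pM _ _ e (lerD h h)) _; last lra.
  by apply: exprn_ge0; lra.
by apply: addr_ge0; apply: sumr_ge0 => i _; apply: exprn_ge0; lra.
Qed.

(** Rounding towards zero shrinks each coordinate, so the norm does not grow. The error per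
    coordinate is at most the mesh, and k meshes squared add up to 1 / 100^2. The loss in squared
    norm is at most twice the mesh times the l1-norm of x, hence at most 1/50. *)
Lemma net_round (x : 'cV[R]_k) : (0 < k)%N -> sqnorm x <= 1 ->
  exists2 z, z \in net &
    [/\ sqnorm (net_point z) <= 1, sqnorm (x - net_point z) <= (1 / 100) ^+ 2 &
        sqnorm x - 1 / 50 <= sqnorm (net_point z)].
Proof.
move=> k0 x1.
have sk0 : 0 < Num.sqrt k%:R :> R by rewrite sqrtr_gt0 ltr0n.
have sk2 : Num.sqrt k%:R ^+ 2 = k%:R :> R by rewrite sqr_sqrtr.
pose D : R := 100 * Num.sqrt k%:R.
have D0 : 0 < D by rewrite mulr_gt0.
pose m j := Num.truncn (`|x j 0| * D).
have mP j : (m j)%:R <= `|x j 0| * D < (m j)%:R + 1.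
  by rewrite natr1; apply: truncn_itv; rewrite mulr_ge0// ltW.
have sum_abs : \sum_j `|x j 0| <= Num.sqrt k%:R.
  rewrite -(@ler_pXn2r _ 2)// ?nnegrE ?sumr_ge0//.
  have := cauchy_schwarz_sum (fun j => `|x j 0|) (fun=> 1).
  under eq_bigr do rewrite mulr1.
  move=> /le_trans; apply; rewrite expr1n sumr_const card_ord sk2.
  under eq_bigr do rewrite real_normK ?num_real//.
  by rewrite ler_piMl.
have sum_m : (\sum_j m j <= 100 * k)%N.
  rewrite -(ler_nat R) natr_sum; apply: (@le_trans _ _ (\sum_j `|x j 0| * D)).
    by apply: ler_sum => j _; have /andP[] := mP j.
  rewrite -mulr_suml natrM -sk2 /D.
  by move: sum_abs; set s := \sum_j _ => hs; nra.
have m_lt j : (m j < (100 * k).+1)%N.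
  by rewrite ltnS; apply: leq_trans sum_m; rewrite (bigD1 j)//= leq_addr.
pose z : net_index := [ffun j => (x j 0 < 0, inord (m j))].
have zE j : net_point z j 0 = (-1) ^+ (x j 0 < 0)%R * ((m j)%:R / D).
  by rewrite mxE ffunE/= inordK.
have xE j : x j 0 = (-1) ^+ (x j 0 < 0)%R * `|x j 0| by exact: numEsign.
have mD j : 0 <= (m j)%:R / D <= `|x j 0|.
  by rewrite divr_ge0 ?(ltW D0)//= ler_pdivrMr//; have /andP[] := mP j.
have mD' j : `|x j 0| - (m j)%:R / D <= D^-1.
  rewrite lerBlDr -[X in X + _]mul1r -mulrDl ler_pdivlMr// addrC ltW//.
  by have /andP[] := mP j.
have DV : D^-1 ^+ 2 * k%:R = (1 / 100) ^+ 2.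
  by rewrite -sk2 /D; field; rewrite gt_eqF.
have Vk : Num.sqrt k%:R * D^-1 = 1 / 100 by rewrite /D; field; rewrite gt_eqF.
exists z; first by rewrite inE; under eq_bigr do rewrite ffunE/= inordK//.
split.
- apply: le_trans x1; apply: ler_sum => j _.
  rewrite zE exprMn sqrr_sign mul1r -[leRHS]real_normK ?num_real//.
  by have /andP[h1 h2] := mD j; rewrite lerXn2r// nnegrE.
- rewrite -DV mulr_natr -[in leRHS](card_ord k) -sumr_const; apply: ler_sum => j _.
  rewrite mxE [X in _ + X]mxE zE {1}xE -mulrBr exprMn sqrr_sign mul1r.
  have /andP[h1 h2] := mD j.
  by rewrite lerXn2r ?nnegrE ?subr_ge0 ?invr_ge0// ltW.
- rewrite lerBlDr.
  have : sqnorm x <= \sum_j (net_point z j 0 ^+ 2 + 2 * (`|x j 0| * D^-1)).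
    apply: ler_sum => j _; rewrite zE exprMn sqrr_sign mul1r.
    rewrite -[leLHS]real_normK ?num_real//.
    have /andP[h1 h2] := mD j; have := mD' j.
    set u := `|x j 0| in h2 *; set v := _ / D in h1 h2 * => h3.
    have V0 : 0 <= D^-1 by rewrite invr_ge0 ltW.
    by nra.
  move=> /le_trans; apply; rewrite big_split/= lerD2l -mulr_sumr -mulr_suml.
  have : (\sum_j `|x j 0|) * D^-1 <= 1 / 100.
    by rewrite -Vk ler_wpM2r// invr_ge0 ltW.
  by lra.
Qed.

End net.

(** * From the net to all vectors, for one fixed matrix *)

Section deterministic_bounds.
Variables (R : realType) (n k : nat) (A : 'M[R]_(n, k)).
Hypothesis k_gt0 : (0 < k)%N.
Hypothesis net_upper : forall z, z \in net k -> sqnorm (net_point R z) <= 1 ->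
  l1norm (A *m net_point R z) <= 2 * n%:R.
Hypothesis net_lower : forall z, z \in net k ->
  49 / 50 <= sqnorm (net_point R z) -> n%:R / 20 <= l1norm (A *m net_point R z).

(** Rounding to the net bounds the supremum M over the unit ball in terms of itself, M <= 2 n + M /
    100; as M is finite, this can be solved for M. *)
Let ball_bound x : sqnorm x <= 1 -> l1norm (A *m x) <= 200 / 99 * n%:R.
Proof.
pose B := [set l1norm (A *m x) | x in [set x : 'cV[R]_k | sqnorm x <= 1]].
have supB : has_sup B.
  split.
    exists (l1norm (A *m 0)), 0 => //=.
    by rewrite /sqnorm big1// => j _; rewrite mxE expr0n.
  exists (\sum_i Num.sqrt (\sum_j A i j ^+ 2)) => _ [y y1 <-].
  exact: l1norm_mulmx_bounded.
have Bub y : sqnorm y <= 1 -> l1norm (A *m y) <= sup B.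
  by move=> y1; apply: sup_upper_bound => //; exists y.
have step : sup B <= 2 * n%:R + sup B / 100.
  apply: ge_sup; first by case: supB.
  move=> _ [y y1 <-]; have [z zN [z1 yz _]] := net_round k_gt0 y1.
  rewrite -[y in l1norm (A *m y)](subrK (net_point R z)) mulmxDr addrC.
  apply: le_trans (l1norm_triangle _ _) _; apply: lerD; first exact: net_upper.
  (* The rounding error has norm at most 1/100, so 100 times it is back in the ball. *)
  have -> : y - net_point R z = (1 / 100) *: (100 *: (y - net_point R z)).
    by rewrite scalerA (_ : 1 / 100 * 100 = 1) ?scale1r//; field.
  rewrite -scalemxAr l1normZ ger0_norm//.
  have := Bub (100 *: (y - net_point R z)); rewrite sqnormZ => h.
  have {}h := h ltac:(lra); lra.
by move=> x1; have := Bub _ x1; lra.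
Qed.

(** The net point nearby gives n / 20, and the rounding error costs at most (200/99) n / 100, which
    leaves more than n / 50. *)
Let sphere_bound x : sqnorm x = 1 -> n%:R / 50 <= l1norm (A *m x).
Proof.
move=> x1; have [|z zN [z1 xz zx]] := net_round (x := x) k_gt0; first by rewrite x1.
have hz : n%:R / 20 <= l1norm (A *m net_point R z) by apply: net_lower => //; lra.
have h100 : l1norm (A *m (100 *: (net_point R z - x))) <= 200 / 99 * n%:R.
  apply: ball_bound; rewrite -opprB scalerN -scaleNr sqnormZ; lra.
have : l1norm (A *m net_point R z) <=
    l1norm (A *m x) + l1norm (A *m (net_point R z - x)).
  by apply: le_trans (l1norm_triangle _ _); rewrite -mulmxDr addrC subrK.
have -> : net_point R z - x = (1 / 100) *: (100 *: (net_point R z - x)).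
  by rewrite scalerA (_ : 1 / 100 * 100 = 1) ?scale1r//; field.
rewrite -[A *m (1 / 100 *: _)]scalemxAr l1normZ ger0_norm; last lra.
have n0 : 0 <= n%:R :> R by []; lra.
Qed.

Lemma l1norm_mulmx_upper x : l1norm (A *m x) <= 3 * n%:R * Num.sqrt (sqnorm x).
Proof.
have [x0|x0] := eqVneq (sqnorm x) 0.
  rewrite (sqnorm_eq0 x0) mulmx0 /l1norm big1 => [|i _]; last by rewrite mxE normr0.
  by rewrite !mulr_ge0.
pose s := Num.sqrt (sqnorm x).
have s0 : 0 < s by rewrite sqrtr_gt0 lt_neqAle eq_sym x0 sqnorm_ge0.
have s2 : s ^+ 2 = sqnorm x by rewrite sqr_sqrtr ?sqnorm_ge0.
have x1 : sqnorm (s^-1 *: x) = 1 by rewrite sqnormZ -s2 -exprMn mulVf ?gt_eqF// expr1n.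
have := @ball_bound (s^-1 *: x); rewrite x1 => /(_ (lexx _)).
rewrite -scalemxAr l1normZ ger0_norm; last by rewrite invr_ge0 ltW.
rewrite ler_pdivrMl// -/s => /le_trans; apply.
rewrite mulrC ler_wpM2r// ?(ltW s0)// ler_wpM2r//; lra.
Qed.

Lemma l1norm_mulmx_lower x : n%:R / 50 * Num.sqrt (sqnorm x) <= l1norm (A *m x).
Proof.
have [x0|x0] := eqVneq (sqnorm x) 0; first by rewrite x0 sqrtr0 mulr0 l1norm_ge0.
pose s := Num.sqrt (sqnorm x).
have s0 : 0 < s by rewrite sqrtr_gt0 lt_neqAle eq_sym x0 sqnorm_ge0.
have s2 : s ^+ 2 = sqnorm x by rewrite sqr_sqrtr ?sqnorm_ge0.
have x1 : sqnorm (s^-1 *: x) = 1 by rewrite sqnormZ -s2 -exprMn mulVf ?gt_eqF// expr1n.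
have := @sphere_bound (s^-1 *: x) x1.
rewrite -scalemxAr l1normZ ger0_norm; last by rewrite invr_ge0 ltW.
by rewrite ler_pdivlMl// -/s mulrC.
Qed.

Variable i : 'I_n.
Local Notation q := (\sum_j A i j ^+ 2).
Hypothesis row_lower : k%:R / 3 <= q.
Hypothesis row_upper : q <= 4 * k%:R.

Lemma min_l1norm_bounds m : is_min (feasible_l1norms A i) m ->
  1 / 100 * (n%:R / Num.sqrt k%:R) <= m <= 6 * (n%:R / Num.sqrt k%:R).
Proof.
have sk0 : 0 < Num.sqrt k%:R :> R by rewrite sqrtr_gt0 ltr0n.
have sk2 : Num.sqrt k%:R ^+ 2 = k%:R :> R by rewrite sqr_sqrtr.
have kR0 : 0 < k%:R :> R by rewrite ltr0n.
have q0 : 0 < q by apply: lt_le_trans row_lower; rewrite divr_gt0.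
have sq0 : 0 < Num.sqrt q by rewrite sqrtr_gt0.
have sq2 : Num.sqrt q ^+ 2 = q by rewrite sqr_sqrtr// ltW.
have n0 : 0 <= n%:R :> R by [].
(* The norm of the row lies between half and twice sqrt k; the factor 2 turns 1/50 into 1/100 and 3
   into 6. *)
have sq_le : Num.sqrt q <= 2 * Num.sqrt k%:R.
  rewrite -(@ler_pXn2r _ 2)// ?nnegrE ?(ltW sq0) ?mulr_ge0// sq2 exprMn sk2.
  by apply: le_trans row_upper _; lra.
have sq_ge : Num.sqrt k%:R / 2 <= Num.sqrt q.
  rewrite -(@ler_pXn2r _ 2)// ?nnegrE ?(ltW sq0) ?mulr_ge0// sq2 exprMn sk2.
  by apply: le_trans row_lower; lra.
move=> [[x /= Ax1 <-] lb]; apply/andP; split.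
  apply: le_trans (l1norm_mulmx_lower x).
  have := norm_mulmx_row_le A x i; rewrite Ax1 normr1 => h.
  have sx0 := sqrtr_ge0 (sqnorm x).
  have h2 : 1 <= 2 * Num.sqrt k%:R * Num.sqrt (sqnorm x).
    by apply: le_trans h _; rewrite ler_wpM2r.
  apply: (@le_trans _ _ (1 / 100 * (n%:R / Num.sqrt k%:R) *
      (2 * Num.sqrt k%:R * Num.sqrt (sqnorm x)))).
    by rewrite ler_peMr// mulr_ge0// divr_ge0// ltW.
  by rewrite le_eqVlt; apply/orP; left; apply/eqP; field; rewrite gt_eqF.
pose y := q^-1 *: (\col_j A i j).
have yE : (A *m y) i 0 = 1.
  have Aa : (A *m (\col_j A i j)) i 0 = q.
    by rewrite mxE; apply: eq_bigr => j _; rewrite mxE expr2.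
  by rewrite -scalemxAr mxE Aa mulVf// gt_eqF.
have qy : Num.sqrt (sqnorm y) = (Num.sqrt q)^-1.
  have -> : sqnorm y = q^-1 ^+ 2 * q.
    by rewrite sqnormZ; congr (_ * _); apply: eq_bigr => j _; rewrite mxE.
  rewrite expr2 -mulrA mulVf ?gt_eqF// mulr1 sqrtrV//; exact: ltW.
apply: (@le_trans _ _ (l1norm (A *m y))); first by apply: lb; exists y.
apply: le_trans (l1norm_mulmx_upper y) _; rewrite qy.
rewrite (_ : 6 * _ = 3 * n%:R * (Num.sqrt k%:R / 2)^-1); last first.
  by field; rewrite gt_eqF.
by rewrite ler_wpM2l ?mulr_ge0// lef_pV2 ?posrE// divr_gt0.
Qed.

Lemma row_neq0 : exists j, A i j != 0.
Proof.
apply/existsP; apply: contraPT row_lower => /existsPn A0; apply/negP.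
rewrite -ltNge big1 ?divr_gt0 ?ltr0n// => j _.
by have := A0 j; rewrite negbK => /eqP ->; rewrite expr0n.
Qed.

End deterministic_bounds.

(** * Existence and measurability of the minimum *)

Lemma continuous_sum (R : realType) (T : topologicalType) (I : finType)
    (f : I -> T -> R) :
  (forall i, continuous (f i)) -> continuous (fun x => \sum_i f i x).
Proof.
move=> cf; elim: (index_enum I) => [|i r IH].
  by under eq_fun do rewrite big_nil; exact: cst_continuous.
by under eq_fun do rewrite big_cons; move=> x; exact: (cvgD (cf i x) (IH x)).
Qed.

Section min_l1norm.
Variables (R : realType) (n k : nat) (A : 'M[R]_(n, k)) (i : 'I_n).

(* The minimum is attained because the range of A, unlike the feasible set of
   vectors x, meets every l1-ball in a compact set. *)
Lemma is_min_feasible_l1norms : (exists j, A i j != 0) ->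
  exists m, is_min (feasible_l1norms A i) m.
Proof.
move=> [j Aij].
pose x0 : 'cV[R]_k := (A i j)^-1 *: delta_mx j 0.
have Ax0 : (A *m x0) i 0 = 1.
  by rewrite -scalemxAr -colE !mxE mulVf.
(* The minimum is sought over image vectors, written as rows: [v *m C = 0] says that [v] is the
   transpose of a vector in the range of [A]. Cutting at the value of the feasible [x0] makes the
   set [D] bounded. *)
pose C := cokermx A^T; pose f (v : 'rV[R]_n) : R := \sum_l `|v 0 l|.
have cf : continuous f.
  apply: continuous_sum => l v; apply: continuous_comp; first exact: coord_continuous.
  exact: norm_continuous.
pose D := [set v : 'rV[R]_n | f v <= l1norm (A *m x0)] `&` [set v | v 0 i = 1] `&`
  \bigcap_l [set v | (v *m C) 0 l = 0].
have closedD : closed D.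
  apply: closedI; first apply: closedI.
  - exact: (proj1 (continuous_closedP f) cf _ (@closed_le R _)).
  - exact: (proj1 (continuous_closedP _) (@coord_continuous R 1 n 0 i) _ (@closed_eq R 1)).
  - apply: closed_bigI => l _.
    have cC : continuous (fun v : 'rV[R]_n => (v *m C) 0 l).
      under eq_fun do rewrite mxE.
      apply: continuous_sum => l' v; apply: continuousM; last exact: cst_continuous.
      exact: coord_continuous.
    exact: (proj1 (continuous_closedP _) cC _ (@closed_eq R 0)).
have boundedD : bounded_set D.
  exists (l1norm (A *m x0)); split; first exact: num_real.
  move=> M BM v [[/= fv _] _] /=; rewrite [leLHS]/Num.Def.normr/= mx_normrE.
  have M0 : 0 <= M by apply: le_trans (ltW BM); exact: l1norm_ge0.
  apply: bigmax_le => // -[a b] _ /=; rewrite (ord1 a).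
  apply: le_trans (ltW BM); apply: le_trans fv.
  by rewrite /f (bigD1 b)//= lerDl sumr_ge0.
have DA x : (A *m x) i 0 = 1 -> l1norm (A *m x) <= l1norm (A *m x0) ->
    D (A *m x)^T.
  move=> Ax1 Axx0; split; first split => /=.
  - by rewrite /f; under eq_bigr do rewrite mxE.
  - by rewrite mxE.
  - move=> l _ /=; have : (x^T *m A^T <= A^T)%MS by exact: submxMl.
    by rewrite submxE -trmx_mul => /eqP; rewrite -/C => ->; rewrite mxE.
have D0 : D !=set0 by exists (A *m x0)^T; exact: DA.
have [v vD vmin] := compact_EVT_min D0 (bounded_closed_compact boundedD closedD)
  (continuous_subspaceT cf).
rewrite inE in vD; case: vD => [[fv v1] vC].
have /submxP[u vu] : (v <= A^T)%MS.
  rewrite submxE; apply/eqP/rowP => l; rewrite -/C.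
  by have /= -> := vC l I; rewrite mxE.
have fE : f v = l1norm (A *m u^T).
  by rewrite vu -[u in u *m _]trmxK -trmx_mul; apply: eq_bigr => l _; rewrite mxE.
exists (f v); split.
  exists u^T; last by rewrite fE.
  by move: v1; rewrite vu -[u in u *m _]trmxK -trmx_mul /= mxE.
move=> _ [x /= Ax1 <-].
have [h|h] := lerP (l1norm (A *m x)) (l1norm (A *m x0)).
  have := vmin (A *m x)^T; rewrite inE => /(_ (DA x Ax1 h)) /le_trans; apply.
  by apply: ler_sum => l _; rewrite mxE.
by apply: le_trans fv _; exact: ltW.
Qed.

(** By homogeneity the constraint can be divided out, and vectors with [(A *m x) i 0 = 0] satisfy
    the inequality trivially. The resulting condition can be tested on rational vectors, whereas the
    feasible set need not contain any. *)
Lemma le_min_l1normP m c : is_min (feasible_l1norms A i) m ->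
  (c <= m <-> forall x, c * `|(A *m x) i 0| <= l1norm (A *m x)).
Proof.
move=> [[x0 /= Ax0 <-] lb]; split => [cm x|/(_ x0)]; last by rewrite Ax0 normr1 mulr1.
have [->|t0] := eqVneq ((A *m x) i 0) 0; first by rewrite normr0 mulr0 l1norm_ge0.
set t := (A *m x) i 0 in t0 *; rewrite -ler_pdivlMr ?normr_gt0//.
apply: le_trans cm _; apply: lb; exists (t^-1 *: x) => /=.
  by rewrite -scalemxAr mxE mulVf.
by rewrite -scalemxAr l1normZ normfV mulrC.
Qed.

Lemma is_min_row_neq0 m : is_min (feasible_l1norms A i) m -> exists j, A i j != 0.
Proof.
move=> [[x /= Ax1 _] _]; apply/existsP; apply: contraT => /existsPn A0.
move: Ax1; rewrite mxE big1 => [/esym/eqP|j _]; first by rewrite oner_eq0.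
by have := A0 j; rewrite negbK => /eqP ->; rewrite mul0r.
Qed.

(** Both sides are Lipschitz in [x], so the inequality passes from a dense set to all vectors. *)
Lemma l1norm_dense (c : R) :
  (forall x : 'cV[rat]_k, c * `|(A *m map_mx ratr x) i 0| <= l1norm (A *m map_mx ratr x)) ->
  forall x, c * `|(A *m x) i 0| <= l1norm (A *m x).
Proof.
move=> H x; apply/ler_addgt0Pr => e e0.
pose S := \sum_l \sum_j `|A l j|.
have S0 : 0 <= S by apply: sumr_ge0 => l _; apply: sumr_ge0.
(* An approximation within [dl] in each coordinate changes the two sides together by at most (1 +
   |c|) dl S <= e; the added 1 keeps the denominator positive. *)
pose dl := e / ((1 + `|c|) * S + 1).
have den0 : 0 < (1 + `|c|) * S + 1 by rewrite ltr_pwDr// mulr_ge0// addr_ge0.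
have dl0 : 0 < dl by rewrite divr_gt0.
have [q qP] : exists q : 'I_k -> rat, forall j, `|x j 0 - ratr (q j)| <= dl.
  have approx j : exists r : rat, `|x j 0 - ratr r| <= dl.
    have [|r] := @rat_in_itvoo R (x j 0 - dl) (x j 0 + dl); first by lra.
    by rewrite in_itv/= => /andP[r1 r2]; exists r; rewrite ler_norml; lra.
  by have [q qP] := boolp.choice approx; exists q.
pose y : 'cV[rat]_k := \col_j q j.
pose u := x - map_mx ratr y.
have Au : l1norm (A *m u) <= dl * S.
  rewrite mulr_sumr; apply: ler_sum => l _; rewrite mxE mulr_sumr.
  apply: le_trans (ler_norm_sum _ _ _) _; apply: ler_sum => j _.
  by rewrite normrM mulrC ler_wpM2r// !mxE; exact: qP.
have Aui : `|(A *m u) i 0| <= dl * S.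
  by apply: le_trans Au; rewrite /l1norm (bigD1 i)//= lerDl sumr_ge0.
have xE : A *m x = A *m map_mx ratr y + A *m u by rewrite -mulmxDr addrC subrK.
have yE : A *m map_mx ratr y = A *m x + - (A *m u) by rewrite xE addrK.
have h1 : l1norm (A *m map_mx ratr y) <= l1norm (A *m x) + l1norm (A *m u).
  rewrite yE; apply: le_trans (l1norm_triangle _ _) _.
  by rewrite -scaleN1r l1normZ normrN1 mul1r.
have h2 : c * (`|(A *m x) i 0| - `|(A *m map_mx ratr y) i 0|) <= `|c| * (dl * S).
  apply: le_trans (ler_norm _) _; rewrite normrM ler_wpM2l//.
  apply: le_trans (ler_dist_dist _ _) _; apply: le_trans Aui.
  rewrite (_ : (A *m x) i 0 - _ = (A *m u) i 0)//.
  by rewrite mulmxBr [RHS]mxE [X in _ = _ + X]mxE.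
have h3 : (1 + `|c|) * (dl * S) <= e.
  rewrite mulrCA mulrA -[leRHS]mulr1 /dl.
  rewrite -[e / _ * _ * _]mulrA -mulrA ler_wpM2l ?(ltW e0)// mulrC ler_pdivrMr// mul1r.
  by rewrite lerDl.
have := H y; lra.
Qed.

End min_l1norm.

Lemma measurable_min_l1norm_event d (T : measurableType d) (R : realType)
    (P : probability T R) (n k : nat) (V : 'I_n -> 'I_k -> {RV P >-> R})
    (i : 'I_n) (a b : R) :
  measurable [set w | exists2 m : R,
    is_min (feasible_l1norms (sample_matrix V w) i) m & a <= m <= b].
Proof.
pose M c := [set w | forall x, c * `|(sample_matrix V w *m x) i 0| <=
  l1norm (sample_matrix V w *m x)].
have mM c : measurable (M c).
  have -> : M c = \bigcap_(x in [set: 'cV[rat]_k])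
      [set w | c * `|(sample_matrix V w *m map_mx ratr x) i 0| <=
        l1norm (sample_matrix V w *m map_mx ratr x)].
    apply/seteqP; split => w /= Mw; first by move=> x _; exact: Mw.
    by apply: l1norm_dense => x; exact: Mw.
  rewrite -[X in measurable X]setCK setC_bigcap; apply: measurableC.
  apply: countable_bigcupT_measurable; first exact: countableP.
  move=> x; apply: measurableC.
  rewrite -[X in measurable X]setTI; apply: measurable_fun_le => //.
    apply: measurable_funM => //; apply: measurableT_comp => //.
    exact: measurable_sample_mulmx.
  exact: measurable_l1norm_sample.
(* The minimum exists exactly when row [i] is nonzero. Then [M c] means c <= m, and m <= b means
   that [M] fails at b + 1 / (l + 1) for every [l]. *)
rewrite [X in measurable X](_ : _ =
  (\big[setU/set0]_(j < k) (V i j @^-1` [set~ 0])) `&` M a `&`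
  \bigcap_l ~` M (b + l.+1%:R^-1)).
  apply: measurableI; first apply: measurableI => //.
    apply: bigsetU_measurable => j _; rewrite -[_ @^-1` _]setTI.
    by apply: measurable_funP => //; apply: measurableC.
  by apply: bigcapT_measurable => l; exact: measurableC.
apply/seteqP; split => w /=.
  move=> [m minm /andP[am mb]]; split; first split.
  - have [j] := is_min_row_neq0 minm; rewrite mxE => Vij.
    by rewrite -bigcup_seq; exists j => //=; [rewrite mem_index_enum|apply/eqP].
  - exact/(le_min_l1normP _ minm).
  - move=> l _ /= /(le_min_l1normP _ minm) /le_trans/(_ mb).
    by rewrite gerDl leNgt invr_gt0 ltr0n.
move=> [[]]; rewrite -bigcup_seq => -[j /= _ Vij] Ma Mb.
have [|m minm] := @is_min_feasible_l1norms _ _ _ (sample_matrix V w) i.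
  by exists j; rewrite mxE; apply/eqP.
exists m => //; apply/andP; split; first exact/(le_min_l1normP _ minm).
apply/ler_addgt0Pr => e e0; rewrite leNgt; apply/negP => bem.
have [l le] : exists l, l.+1%:R^-1 < e.
  by have [l] := ltr_add_invr e0; exists l; rewrite -[X in X < _]add0r.
apply: (Mb l I); apply/(le_min_l1normP _ minm).
by apply: le_trans (ltW bem); rewrite lerD2l ltW.
Qed.

(** * The probability estimate *)

Lemma le_measure_bigsetU d (T : measurableType d) (R : realType)
    (mu : {measure set T -> \bar R}) (I : Type) (r : seq I) (Q : pred I)
    (F : I -> set T) :
  (forall i, measurable (F i)) ->
  (mu (\big[setU/set0]_(i <- r | Q i) F i) <= \sum_(i <- r | Q i) mu (F i))%E.
Proof.
move=> mF; elim: r => [|i r IH]; first by rewrite !big_nil measure0.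
rewrite !big_cons; case: ifP => // _.
apply: (le_trans (measureU2 _ _ _)) => //; last exact: leeD2l.
exact: bigsetU_measurable.
Qed.

Lemma expr_le_expR (R : realType) (r : R) m : 0 <= r <= 39 / 40 ->
  r ^+ m <= expR (- (1 / 40) * m%:R).
Proof.
move=> /andP[r0 r1]; rewrite mulrC expRM_natl lerXn2r ?nnegrE ?expR_ge0//.
by apply: le_trans r1 _; apply: le_trans (expR_ge1Dx _); lra.
Qed.

Theorem lemma3 (R : realType) :
  exists c C C1 c1 : R,
    [/\ 0 < c, 0 < C, 0 < C1 & 0 < c1] /\
    forall (n k : nat) (istar : 'I_n),
      (1 <= k)%N -> (k%:R : R) <= n%:R / 16 ->
    forall (d : measure_display) (T : measurableType d) (P : probability T R)
      (V : 'I_n -> 'I_k -> {RV P >-> R}),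
      iid_standard_normal_entries V ->
      with_probability_at_least P
        (1 - C1 * (expR (- c1 * n%:R) + expR (- c1 * k%:R)))
        [set w | exists2 m : R,
           is_min (feasible_l1norms (sample_matrix V w) istar) m &
           c * (n%:R / Num.sqrt k%:R) <= m <= C * (n%:R / Num.sqrt k%:R)].
Proof.
(* The first two constants come from [min_l1norm_bounds]. The factor 2 counts the two tails at each
   net point and the two tails of the row; 1/40 is the rate of [expr_le_expR]. *)
exists (1 / 100), 6, 2, (1 / 40); split; first by split; lra.
move=> n k i k0 kn d T P V iidV; split; first exact: measurable_min_l1norm_event.
set E := [set w | _].
have mE : measurable E by exact: measurable_min_l1norm_event.
(* The bad events are empty where the norm condition of the tail bound fails, so the same estimate
   holds at every net point. *)
pose U (y : 'cV[R]_k) := if sqnorm y <= 1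
  then [set w | (2 * n%:R <= l1norm (sample_matrix V w *m y))%R] else set0.
pose L (y : 'cV[R]_k) := if 49 / 50 <= sqnorm y
  then [set w | (l1norm (sample_matrix V w *m y) <= n%:R / 20)%R] else set0.
pose S1 := [set w | (4 * k%:R <= \sum_j V i j w ^+ 2)%R].
pose S2 := [set w | (\sum_j V i j w ^+ 2 <= k%:R / 3)%R].
have mU y : measurable (U y).
  rewrite /U; case: ifP => // _; rewrite -[X in measurable X]setTI.
  apply: (measurable_fun_le (f := cst (2 * n%:R))) => //.
  exact: measurable_l1norm_sample.
have mL y : measurable (L y).
  rewrite /L; case: ifP => // _; rewrite -[X in measurable X]setTI.
  apply: (measurable_fun_le (g := cst (n%:R / 20))) => //.
  exact: measurable_l1norm_sample.
have mS1 : measurable S1.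
  rewrite -[X in measurable X]setTI.
  by apply: (measurable_fun_le (f := cst (4 * k%:R))) => //; exact: measurable_row_sqr.
have mS2 : measurable S2.
  rewrite -[X in measurable X]setTI.
  by apply: (measurable_fun_le (g := cst (k%:R / 3))) => //; exact: measurable_row_sqr.
have PU y : (P (U y) <= ((13 / 20) ^+ n)%:E)%E.
  rewrite /U; case: ifP => [|_]; first exact: l1norm_sample_upper_tail.
  by rewrite measure0 lee_fin exprn_ge0.
have PL y : (P (L y) <= ((13 / 20) ^+ n)%:E)%E.
  rewrite /L; case: ifP => [|_]; first exact: l1norm_sample_lower_tail.
  by rewrite measure0 lee_fin exprn_ge0.
pose N := \big[setU/set0]_(z in net k) (U (net_point R z) `|` L (net_point R z)).
have mN : measurable N by apply: bigsetU_measurable => z _; exact: measurableU.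
have PN : (P N <= (2 * (39 / 40) ^+ n)%:E)%E.
  apply: (@le_trans _ _ (\sum_(z in net k) (2 * (13 / 20) ^+ n)%:E)%E).
    apply: (le_trans (le_measure_bigsetU _ _ _ _)) => [z|]; first exact: measurableU.
    apply: lee_sum => z _; apply: (le_trans (measureU2 _ _ _)) => //.
    by rewrite mulr_natl mulr2n EFinD leeD ?PU ?PL.
  rewrite sumEFin lee_fin sumr_const -[X in X <= _]mulr_natr -mulrA.
  (* The union bound costs a factor 606^k. As 606 <= (3/2)^16 and 16 k <= n, the rate is still
     (13/20) (3/2) = 39/40 < 1. *)
  have -> : 39 / 40 = 13 / 20 * (3 / 2) :> R by field.
  rewrite [X in _ <= _ * X]exprMn ler_wpM2l// ler_wpM2l ?exprn_ge0//.
  apply: le_trans (card_net_le R k) _.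
  have kn16 : (16 * k <= n)%N by rewrite -(ler_nat R) natrM; lra.
  apply: (@le_trans _ _ ((3 / 2) ^+ (16 * k))).
    by rewrite exprM; apply: lerXn2r; rewrite ?nnegrE; lra.
  by apply: ler_weXn2l => //; lra.
(* Outside the bad events all hypotheses of the deterministic bounds hold, and the lower bound on
   the row also makes the minimum exist. *)
have NE : ~` E `<=` N `|` (S1 `|` S2).
  move=> w; apply: contra_notP => /not_orP[Nw /not_orP[/negP S1w /negP S2w]].
  have Nz z : z \in net k -> ~ U (net_point R z) w /\ ~ L (net_point R z) w.
    move=> zN; split => Hw; apply: Nw; rewrite /N -bigcup_seq_cond.
      by exists z => /=; [rewrite mem_index_enum|left].
    by exists z => /=; [rewrite mem_index_enum|right].
  rewrite -ltNge in S1w; rewrite -ltNge in S2w.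
  have qE : \sum_j sample_matrix V w i j ^+ 2 = \sum_j V i j w ^+ 2.
    by apply: eq_bigr => j _; rewrite mxE.
  have lo : k%:R / 3 <= \sum_j sample_matrix V w i j ^+ 2 by rewrite qE ltW.
  have hi : \sum_j sample_matrix V w i j ^+ 2 <= 4 * k%:R by rewrite qE ltW.
  have [m minm] := is_min_feasible_l1norms (row_neq0 k0 lo).
  exists m => //; apply: min_l1norm_bounds minm => //.
    move=> z zN z1; have [+ _] := Nz z zN; rewrite /U z1 => /negP.
    by rewrite -ltNge => /ltW.
  move=> z zN z1; have [_] := Nz z zN; rewrite /L z1 => /negP.
  by rewrite -ltNge => /ltW.
have PE : (P (~` E) <= (2 * (expR (- (1 / 40) * n%:R) + expR (- (1 / 40) * k%:R)))%:E)%E.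
  apply: (@le_trans _ _ (P (N `|` (S1 `|` S2)))).
    apply: le_measure; rewrite ?inE//; first exact: measurableC.
    by apply: measurableU => //; exact: measurableU.
  apply: (le_trans (measureU2 _ _ _)) => //; first exact: measurableU.
  apply: (@le_trans _ _ (2 * (39 / 40) ^+ n + ((13 / 20) ^+ k + (7 / 8) ^+ k))%:E).
    rewrite EFinD leeD//; apply: (le_trans (measureU2 _ _ _)) => //.
    rewrite EFinD leeD//; first exact: row_sqr_upper_tail.
    exact: row_sqr_lower_tail.
  rewrite lee_fin.
  have h1 := @expr_le_expR R (39 / 40) n ltac:(lra).
  have h2 := @expr_le_expR R (13 / 20) k ltac:(lra).
  have h3 := @expr_le_expR R (7 / 8) k ltac:(lra).
  lra.
rewrite -[E]setCK probability_setC; last exact: measurableC.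
by rewrite EFinB leeB.
Qed.
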